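(* Let $G$ be a finite connected graph with Laplacian matrix $Q$. If the system $\frac{dx_i}{dt}=\sum_{j\sim i}\left[r(x_i-x_j)-(x_i-x_j)^3\right]$ on $G$ has a stationary state $\mathbf{x}^\star\in X$ which is also a Laplacian eigenvector satisfying $Q\mathbf{x}^\star=\mu\mathbf{x}^\star$, then the exact solution for initial state $\mathbf{x}_0=\alpha_0\mathbf{x}^\star$ and $r>0$ is given by $$\mathbf{x}(t,\mathbf{x}_0)=\mathbf{x}_0\left(\alpha_0^2-\left(\alpha_0^2-1\right)e^{-2\mu rt}\right)^{-1/2}.$$ In particular, the system will reach the stationary state: $\lim_{t\to\infty}\mathbf{x}(t,\mathbf{x}_0)=\mathbf{x}^\star$.
   Context: $G$ is an undirected graph with $N$ nodes whose links connect pairs of distinct nodes; $i\sim j$ means that $i$ and $j$ are linked. Each node $i$ has a real state value $x_i(t)$, and $\mathbf{x}(t)=(x_1(t),\dots,x_N(t))$ is the system state; $r$ is a real scalar parameter and $\alpha_0$ is a real scalar. The state space is $X=\mathbb{R}^N/\mathbf{1}$: two states are identified if they differ by a constant vector. An element of $X$ may be represented by its unique representative with zero average (the dynamics conserve the average), and an eigenvector $\mathbf{x}^\star\in X$ of $Q$ is a nonzero element of $X$ so represented. A stationary state is a state at which $d\mathbf{x}/dt=0$, i.e. all right-hand sides of the system vanish. $\mathbf{x}(t,\mathbf{x}_0)$ denotes the solution at time $t$ of the system with initial condition $\mathbf{x}(0)=\mathbf{x}_0$. The Laplacian $Q$ of $G$ is the $N\times N$ matrix with entries $Q_{ii}=d_i$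 (the degree, i.e. number of neighbours, of $i$), $Q_{ij}=-1$ if $i\sim j$, and $0$ otherwise.
   Formalization: The limit x(t,x_0) → x* is asserted only for α_0 > 0, since for α_0 = 0 the solution stays at 0 and for α_0 < 0 it tends to −x*; the solution is taken for times t ≥ 0. *)

(* Defs.v *)
From mathcomp Require Import all_boot all_order all_algebra.
From mathcomp Require Import all_classical all_reals all_analysis.
Set Implicit Arguments.
Unset Strict Implicit.
Unset Printing Implicit Defensive.
Import Order.TTheory GRing.Theory Num.Theory.
Import numFieldNormedType.Exports.
Local Open Scope classical_set_scope.
Local Open Scope ring_scope.

Definition simple_graph (N : nat) (e : rel 'I_N) : Prop :=
  symmetric e /\ irreflexive e.

Definition connected_graph (N : nat) (e : rel 'I_N) : Prop :=
  forall i j : 'I_N, connect e i j.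

Definition degree (N : nat) (e : rel 'I_N) (i : 'I_N) : nat :=
  #|[set j | e i j]%SET|.

Definition laplacian (R : realType) (N : nat) (e : rel 'I_N) : 'M[R]_N :=
  \matrix_(i, j) (if i == j then (degree e i)%:R
                  else if e i j then -1 else 0).

Definition rhs (R : realType) (N : nat) (e : rel 'I_N) (r : R)
    (x : 'cV[R]_N) : 'cV[R]_N :=
  \col_i \sum_(j < N | e j i)
    (r * (x i 0 - x j 0) - (x i 0 - x j 0) ^+ 3).

Definition stationary (R : realType) (N : nat) (e : rel 'I_N) (r : R)
    (x : 'cV[R]_N) : Prop :=
  rhs e r x = 0.

Definition average (R : realType) (N : nat) (x : 'cV[R]_N) : R :=
  (\sum_(i < N) x i 0) / N%:R.

(* An eigenvector in the state space R^N / 1: elements of the quotient are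
   represented by their unique representative with zero average, so that
   being nonzero in the quotient is being nonzero as a vector. *)
Definition laplacian_eigenvector (R : realType) (N : nat) (e : rel 'I_N)
    (mu : R) (x : 'cV[R]_N) : Prop :=
  [/\ average x = 0, x != 0 & laplacian R e *m x = mu *: x].

(* Solution on [0, +oo[ of the initial value problem. The equation also holds
   at t = 0, where dx/dt is the right derivative; only the values of x at
   nonnegative times matter. For zero-average x0 this is the same as a solution
   in R^N / 1, because the dynamics conserve the average. *)
Definition is_solution (R : realType) (N : nat) (e : rel 'I_N) (r : R)
    (x0 : 'cV[R]_N) (x : R -> 'cV[R]_N) : Prop :=
  [/\ x 0 = x0,
      forall i : 'I_N,
        h^-1 * (x h i 0 - x 0 i 0) @[h --> 0^'+] --> rhs e r (x 0) i 0
    & forall (t : R) (i : 'I_N), 0 < t ->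
        is_derive t 1 (fun s : R => x s i 0) (rhs e r (x t) i 0)].

(* Main.v *)
Require Import Defs.
From mathcomp Require Import all_boot all_order all_algebra.
From mathcomp Require Import all_classical all_reals all_analysis.
From mathcomp Require Import ring.
Set Implicit Arguments.
Unset Strict Implicit.
Unset Printing Implicit Defensive.
Import Order.TTheory GRing.Theory Num.Theory.
Import numFieldNormedType.Exports.
Local Open Scope classical_set_scope.
Local Open Scope ring_scope.

(** Stationarity of an eigenvector [x] with eigenvalue [mu] expresses the cubic
    coupling through the linear one: at every node the sum of the cubes
    [(x i - x j) ^ 3] over the neighbours equals [r * mu * x i].  On the line
    spanned by [x] the vector field is therefore
    [rhs (a x) = r mu (a - a ^ 3) x] ([rhs_ray]), so this line is invariant and
    the system reduces on it to the Bernoulli equation [a' = k (a - a ^ 3)] with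
    [k = mu r], which becomes linear in [a ^ - 2] and has the closed form
    [bernoulli_amplitude].

    On a connected graph an eigenvector of zero average is not constant, so its
    Rayleigh quotient gives [mu > 0] ([laplacian_eigenvalue_gt0]).  This makes
    the exponential decay: the expression under the power stays positive for
    [t >= 0], and the amplitude tends to [1] when [alpha0 > 0].

    That every solution coincides with the explicit one follows from an energy
    estimate rather than from local Lipschitz bounds.  The cube is monotone, so
    the vector field is one-sided Lipschitz with a constant valid on the whole
    space ([rhs_one_sided_lipschitz]), and the squared distance of two solutions
    satisfies [E' <= C E]; it vanishes initially, hence forever
    ([gronwall_eq0], [is_solution_unique]). *)

(** * Sums over the edges of a graph *)

(** Each edge occurs in the double sum in both orientations; exchanging its
    endpoints changes the sign of [F], which turns [y j] into [- y i].  Both the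
    Laplacian and the full vector field have this antisymmetric form. *)
Lemma sum_by_parts (R : comNzRingType) (N : nat) (e : rel 'I_N)
    (y : 'I_N -> R) (F : 'I_N -> 'I_N -> R) :
  symmetric e -> (forall i j, F j i = - F i j) ->
  2 * (\sum_i y i * \sum_(j < N | e j i) F i j) =
  \sum_i \sum_(j < N | e j i) (y i - y j) * F i j.
Proof.
move=> e_sym F_anti.
have swap : \sum_i \sum_(j < N | e j i) y j * F i j =
            - \sum_i \sum_(j < N | e j i) y i * F i j.
  rewrite (exchange_big_dep predT) //= -sumrN; apply: eq_bigr => i _.
  rewrite -sumrN; apply: eq_big => [j|j _]; first exact: e_sym.
  by rewrite F_anti mulrN.
under [RHS]eq_bigr do under eq_bigr do rewrite mulrBl.
under [RHS]eq_bigr do rewrite sumrB.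
rewrite sumrB swap opprK mulr_natl mulr2n.
by congr (_ + _); apply: eq_bigr => i _; rewrite mulr_sumr.
Qed.

Lemma mul_laplacianE (R : realType) (N : nat) (e : rel 'I_N) (x : 'cV[R]_N)
    (i : 'I_N) :
  simple_graph e ->
  (laplacian R e *m x) i 0 = \sum_(j < N | e j i) (x i 0 - x j 0).
Proof.
move=> [e_sym e_irr]; rewrite mxE (bigD1 i) //= !mxE eqxx sumrB.
congr (_ + _).
  rewrite sumr_const mulr_natl /degree cardsE; congr (_ *+ _).
  by apply: eq_card => j; rewrite unfold_in e_sym.
rewrite -sumrN big_mkcond [RHS]big_mkcond /=; apply: eq_bigr => j _.
rewrite !mxE e_sym eq_sym; case: eqVneq => [->|_] /=; first by rewrite e_irr.
by case: (e j i); rewrite ?mul0r // mulN1r.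
Qed.

Lemma connected_edge_const (T : Type) (N : nat) (e : rel 'I_N)
    (x : 'I_N -> T) :
  connected_graph e -> (forall i j, e i j -> x i = x j) ->
  forall i j, x i = x j.
Proof.
move=> e_conn x_edge i j; have /connectP[p] := e_conn i j.
elim: p i => [|k p IHp] i /=; first by move=> _ ->.
by move=> /andP[/x_edge -> /IHp]; apply.
Qed.

(** Summation by parts gives [2 mu |x|^2] as the Dirichlet sum of the squares
    [(x i - x j) ^ 2] over the oriented edges.  If [mu <= 0], all of them vanish, [x] is
    constant by connectedness, and zero average forces [x = 0]. *)
Lemma laplacian_eigenvalue_gt0 (R : realType) (N : nat) (e : rel 'I_N)
    (mu : R) (x : 'cV[R]_N) :
  simple_graph e -> connected_graph e -> laplacian_eigenvector e mu x ->
  0 < mu.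
Proof.
move=> e_simple e_conn [x_avg x_neq0 x_eig]; have [e_sym _] := e_simple.
have rayleigh : 2 * (mu * \sum_i x i 0 ^+ 2) =
    \sum_i \sum_(j < N | e j i) (x i 0 - x j 0) ^+ 2.
  rewrite -(sum_by_parts (fun i => x i 0) e_sym); last first.
    by move=> i j; rewrite opprB.
  congr (2 * _); rewrite mulr_sumr; apply: eq_bigr => i _.
  by rewrite -mul_laplacianE // x_eig mxE; ring.
rewrite ltNge; apply/negP => mu_le0.
have x_edge i j : e j i -> x j 0 = x i 0.
  move=> eji; have sum_eq0 :
      \sum_i \sum_(j < N | e j i) (x i 0 - x j 0) ^+ 2 = 0.
    apply/eqP; rewrite eq_le -{1}rayleigh pmulr_rle0 // mulr_le0_ge0 //=.
      by do 2!apply: sumr_ge0 => ? _; rewrite sqr_ge0.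
    by apply: sumr_ge0 => ? _; rewrite sqr_ge0.
  have /psumr_eq0P/(_ i isT)/psumr_eq0P/(_ j eji) := sum_eq0.
  move=> H; apply/esym/eqP; rewrite -subr_eq0 -sqrf_eq0; apply/eqP/H.
    by move=> ? _; rewrite sqr_ge0.
  by move=> ? _; apply: sumr_ge0 => ? _; rewrite sqr_ge0.
have x_const := @connected_edge_const _ _ _ (fun i => x i 0) e_conn
  (fun i j => x_edge j i).
case/eqP: x_neq0; apply/colP => i; rewrite mxE.
have N_neq0 : N%:R != 0 :> R by rewrite pnatr_eq0 -lt0n (leq_trans _ (ltn_ord i)).
have x_sum : \sum_j x j 0 = N%:R * x i 0.
  rewrite (eq_bigr (fun=> x i 0) (fun j _ => x_const j i)).
  by rewrite sumr_const card_ord mulr_natl.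
by move: x_avg; rewrite /average x_sum mulrC mulKf.
Qed.

(** * The vector field *)

(** The linear part of the field has degree one in [a] and the cubic part degree
    three; stationarity at [a = 1] fixes the ratio of the two, so both are
    multiples of the eigenvector. *)
Lemma rhs_ray (R : realType) (N : nat) (e : rel 'I_N) (r mu a : R)
    (x : 'cV[R]_N) :
  simple_graph e -> stationary e r x -> laplacian R e *m x = mu *: x ->
  rhs e r (a *: x) = (r * mu * (a - a ^+ 3)) *: x.
Proof.
move=> e_simple x_stat x_eig; apply/colP => i.
have lap_i : \sum_(j < N | e j i) (x i 0 - x j 0) = mu * x i 0.
  by rewrite -mul_laplacianE // x_eig mxE.
have cube_i : \sum_(j < N | e j i) (x i 0 - x j 0) ^+ 3 = r * (mu * x i 0).
  have /colP/(_ i) := x_stat; rewrite !mxE sumrB -mulr_sumr lap_i => /eqP.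
  by rewrite subr_eq0 => /eqP.
rewrite !mxE.
rewrite (eq_bigr (fun j => a * r * (x i 0 - x j 0)
                           - a ^+ 3 * (x i 0 - x j 0) ^+ 3)); last first.
  by move=> j _; rewrite !mxE; ring.
by rewrite sumrB -!mulr_sumr lap_i cube_i; ring.
Qed.

(** By parts, the left-hand side is a sum over oriented edges of
    [(u - v) (phi u - phi v)], with [phi u = r u - u ^ 3] and with [u],
    [v] the differences of [x], [y] along the edge.  Only the linear part of [phi] can make a term positive,
    since the cube is increasing; no bound on [x] and [y] is involved. *)
Lemma rhs_one_sided_lipschitz (R : realType) (N : nat) (e : rel 'I_N) (r : R)
    (x y : 'cV[R]_N) :
  symmetric e -> 0 <= r ->
  2 * \sum_i (x i 0 - y i 0) * (rhs e r x i 0 - rhs e r y i 0) <=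
  4 * r * N%:R * \sum_i (x i 0 - y i 0) ^+ 2.
Proof.
move=> e_sym r_ge0.
pose phi (u : R) := r * u - u ^+ 3.
pose d i := x i 0 - y i 0.
pose F i j := phi (x i 0 - x j 0) - phi (y i 0 - y j 0).
have -> : \sum_i (x i 0 - y i 0) * (rhs e r x i 0 - rhs e r y i 0) =
          \sum_i d i * \sum_(j < N | e j i) F i j.
  by apply: eq_bigr => i _; rewrite !mxE -sumrB.
rewrite sum_by_parts //; last by move=> i j; rewrite /F /phi; ring.
have edge_le i j : (d i - d j) * F i j <= 2 * r * (d i ^+ 2 + d j ^+ 2).
  have -> : (d i - d j) * F i j =
    r * (d i - d j) ^+ 2 - (d i - d j) ^+ 2 *
      ((x i 0 - x j 0) ^+ 2 + (x i 0 - x j 0) * (y i 0 - y j 0)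
       + (y i 0 - y j 0) ^+ 2).
    by rewrite /F /phi /d; ring.
  have quad_ge0 (u v : R) : 0 <= u ^+ 2 + u * v + v ^+ 2.
    have -> : u ^+ 2 + u * v + v ^+ 2 = (u + v / 2) ^+ 2 + 3 * (v / 2) ^+ 2.
      by field.
    by rewrite addr_ge0 ?sqr_ge0 // mulr_ge0 ?sqr_ge0.
  apply: (@le_trans _ _ (r * (d i - d j) ^+ 2)).
    by rewrite lerBlDr lerDl mulr_ge0 ?sqr_ge0.
  rewrite -subr_ge0.
  have -> : 2 * r * (d i ^+ 2 + d j ^+ 2) - r * (d i - d j) ^+ 2 =
            r * (d i + d j) ^+ 2 by ring.
  by rewrite mulr_ge0 ?sqr_ge0.
(* The crude bound by all ordered pairs, instead of edges, yields the factor N. *)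
apply: (@le_trans _ _ (\sum_i \sum_j 2 * r * (d i ^+ 2 + d j ^+ 2))).
  apply: ler_sum => i _; rewrite big_mkcond; apply: ler_sum => j _.
  by case: (e j i) => //; rewrite !mulr_ge0 // addr_ge0 ?sqr_ge0.
rewrite le_eqVlt; apply/orP; left; apply/eqP.
have -> : \sum_i \sum_j 2 * r * (d i ^+ 2 + d j ^+ 2) =
          \sum_(i < N) 2 * r * (N%:R * d i ^+ 2 + \sum_(j < N) d j ^+ 2).
  apply: eq_bigr => i _; rewrite -mulr_sumr big_split /= sumr_const card_ord.
  by rewrite -[_ *+ N]mulr_natl.
rewrite -mulr_sumr big_split /= -mulr_sumr sumr_const card_ord -[_ *+ N]mulr_natl.
by rewrite -/d; ring.
Qed.

(** * Uniqueness of solutions *)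

(** The function [expR (- C t) * E t] is nonnegative and nonincreasing on
    [t >= 0], and it starts at [0].  Differentiability is assumed only for
    [t > 0], which is why right continuity at [0] is a separate hypothesis. *)
Lemma gronwall_eq0 (R : realType) (E dE : R -> R) (C : R) :
  E 0 = 0 -> (forall t : R, 0 <= E t) -> E t @[t --> 0^'+] --> E 0 ->
  (forall t : R, 0 < t -> is_derive t 1 E (dE t)) ->
  (forall t : R, 0 < t -> dE t <= C * E t) ->
  forall t : R, 0 <= t -> E t = 0.
Proof.
move=> E0 E_ge0 E_right0 E_derive dE_le t t_ge0.
pose W (s : R) := expR (- C * s) * E s.
have W_derive (s : R) : 0 < s ->
    is_derive s 1 W (expR (- C * s) * (dE s - C * E s)).
  move=> s_gt0; have dEs := E_derive s s_gt0.
  have dlin : is_derive s 1 (fun u : R => - C * u) (- C).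
    have := is_deriveZ (- C) (is_derive_id s (1 : R)).
    by rewrite /GRing.scale /= mulr1.
  have dexp := is_derive1_comp (is_derive_expR (- C * s)) dlin.
  apply: is_derive_eq (is_deriveM dexp dEs) _.
  by rewrite /GRing.scale /=; ring.
have W_nincr : forall u v, 0 <= u -> u <= v -> W v <= W u.
  apply: ler0_derive1_nincry.
  - by move=> s; rewrite in_itv /= andbT => /W_derive [].
  - move=> s; rewrite in_itv /= andbT => s_gt0.
    have [_ Ws] := W_derive s s_gt0.
    by rewrite derive1E Ws mulr_ge0_le0 ?expR_ge0 // subr_le0 dE_le.
  - apply/continuous_within_itvcyP; split.
      move=> s; rewrite in_itv /= andbT => /W_derive [Ws _].
      exact/differentiable_continuous/derivable1_diffP.
    apply: cvgM => //; apply: cvg_at_right_filter.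
    apply: continuous_comp; last exact: continuous_expR.
    exact: mulrl_continuous.
have := W_nincr 0 t (lexx _) t_ge0; rewrite /W E0 mulr0 pmulr_rle0 ?expR_gt0 //.
by move=> E_le0; apply/eqP; rewrite eq_le E_le0 E_ge0.
Qed.

(** This supplies the right continuity required by [gronwall_eq0] from the
    one-sided differential equation at time [0]. *)
Lemma right_derivative_continuous (R : realType) (f : R -> R) (l : R) :
  h^-1 * (f h - f 0) @[h --> 0^'+] --> l -> f h @[h --> 0^'+] --> f 0.
Proof.
move=> f_quot; rewrite -[f 0 in X in _ --> X]addr0 -[X in _ + X](mul0r l).
have id_cvg : (h : R) @[h --> 0^'+] --> (0 : R).
  by apply: cvg_at_right_filter; exact: cvg_id.
have cst_cvg : f 0 @[_ --> (0 : R)^'+] --> f 0 by exact: cvg_cst.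
apply: cvg_trans (cvgD cst_cvg (cvgM id_cvg f_quot)); apply: near_eq_cvg; near=> h.
rewrite fctE /= mulrA divff; first by rewrite mul1r addrC subrK.
by rewrite gt_eqF //; near: h; exact: nbhs_right_gt.
Unshelve. all: by end_near. Qed.

Lemma is_solution_unique (R : realType) (N : nat) (e : rel 'I_N) (r : R)
    (x0 : 'cV[R]_N) (x y : R -> 'cV[R]_N) :
  symmetric e -> 0 <= r -> is_solution e r x0 x -> is_solution e r x0 y ->
  forall t : R, 0 <= t -> x t = y t.
Proof.
move=> e_sym r_ge0 [x_init x_right x_deriv] [y_init y_right y_deriv] t t_ge0.
pose E (s : R) := \sum_i (x s i 0 - y s i 0) ^+ 2.
pose dE (s : R) := 2 * \sum_i (x s i 0 - y s i 0)
                              * (rhs e r (x s) i 0 - rhs e r (y s) i 0).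
have E0 : E 0 = 0.
  by rewrite /E big1 // => i _; rewrite x_init y_init subrr expr0n.
have E_ge0 s : 0 <= E s by apply: sumr_ge0 => i _; rewrite sqr_ge0.
have /eqP : E t = 0.
  apply: (@gronwall_eq0 R E dE (4 * r * N%:R)) => //.
  - rewrite /E; apply: cvg_big => [|i _]; first exact: add_continuous.
    by apply: cvgM; apply: cvgB; apply: right_derivative_continuous;
      [exact: x_right | exact: y_right | exact: x_right | exact: y_right].
  - move=> s s_gt0; rewrite /E /dE.
    have -> : (fun s0 => \sum_i (x s0 i 0 - y s0 i 0) ^+ 2) =
      \sum_i (((fun s0 : R => x s0 i 0) - (fun s0 : R => y s0 i 0)) ^+ 2).
      by apply/funext => s0; rewrite fct_sumE.
    apply: is_derive_eq.
      apply: is_derive_sum => i.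
      by apply: is_deriveX; apply: is_deriveB; [exact: x_deriv | exact: y_deriv].
    rewrite mulr_sumr; apply: eq_bigr => i _.
    by rewrite /GRing.scale /= expr1 -mulrA.
  - by move=> s s_gt0; exact: rhs_one_sided_lipschitz.
rewrite psumr_eq0; last by move=> i _; rewrite sqr_ge0.
move=> /allP E_eq0; apply/colP => i.
have := E_eq0 i (mem_index_enum _); rewrite sqrf_eq0 subr_eq0.
by move=> /eqP.
Qed.

(** * The Bernoulli equation for the amplitude *)

(** Along a solution [a] of [a' = k (a - a ^ 3)] with [a 0 = a0 <> 0], this is
    [(a0 / a t) ^ 2].  Normalising by [a0] instead of using [a t ^ - 2] keeps the
    formula meaningful when [a0 = 0]. *)
Definition bernoulli_base (R : realType) (k a0 t : R) : R :=
  a0 ^+ 2 - (a0 ^+ 2 - 1) * expR (- 2 * k * t).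

Definition bernoulli_amplitude (R : realType) (k a0 t : R) : R :=
  bernoulli_base k a0 t `^ (- 2^-1) * a0.

(** With [E = expR (- 2 k t)] in ]0, 1], the base is the convex combination of
    [a0 ^ 2] and [1] with weights [1 - E] and [E]. *)
Lemma bernoulli_base_gt0 (R : realType) (k a0 t : R) :
  0 < k -> 0 <= t -> 0 < bernoulli_base k a0 t.
Proof.
move=> k_gt0 t_ge0; set E := expR (- 2 * k * t).
have E_le1 : E <= 1 by rewrite expR_le1 -mulrA mulNr oppr_le0 !mulr_ge0 // ltW.
have -> : bernoulli_base k a0 t = a0 ^+ 2 * (1 - E) + E.
  by rewrite /bernoulli_base -/E; ring.
by rewrite ltr_wpDl ?expR_gt0 // mulr_ge0 ?sqr_ge0 // subr_ge0.
Qed.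

Lemma bernoulli_amplitude0 (R : realType) (k a0 : R) :
  bernoulli_amplitude k a0 0 = a0.
Proof.
by rewrite /bernoulli_amplitude /bernoulli_base mulr0 expR0 mulr1 subKr powR1 mul1r.
Qed.

(** The base [b] satisfies [b' = 2 k (a0 ^ 2 - b)].  In terms of
    [p = b ^ (- 1 / 2)], the chain rule gives [- k p ^ 3 a0 (a0 ^ 2 - b)], and
    [b p ^ 2 = 1] turns it into [k (p a0 - (p a0) ^ 3)]. *)
Lemma is_derive_bernoulli_amplitude (R : realType) (k a0 t : R) :
  0 < bernoulli_base k a0 t ->
  is_derive t 1 (bernoulli_amplitude k a0)
    (k * (bernoulli_amplitude k a0 t - bernoulli_amplitude k a0 t ^+ 3)).
Proof.
move=> b_gt0; set b := bernoulli_base k a0 in b_gt0 *.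
set E := expR (- 2 * k * t).
have dlin : is_derive t 1 (fun u : R => - 2 * k * u) (- 2 * k).
  have := is_deriveZ (- 2 * k) (is_derive_id t (1 : R)).
  by rewrite /GRing.scale /= mulr1.
have dexp := is_derive1_comp (is_derive_expR (- 2 * k * t)) dlin.
have dbase : is_derive t 1 b (2 * k * (a0 ^+ 2 - 1) * E).
  apply: is_derive_eq (is_deriveB (is_derive_cst (a0 ^+ 2) t 1)
                        (is_deriveZ (a0 ^+ 2 - 1) dexp)) _.
  by rewrite /GRing.scale /= -/E; ring.
have dpow := is_derive1_comp (is_derive1_powR (- 2^-1) b_gt0) dbase.
set p := b t `^ (- 2^-1).
have p_sqr : p ^+ 2 = (b t)^-1.
  rewrite -powR_mulrn ?powR_ge0 // -powRrM mulNr mulVf ?pnatr_eq0 //.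
  by rewrite powR_inv1 // ltW.
have p_pred : b t `^ (- 2^-1 - 1) = p ^+ 3.
  rewrite powRD ?(gt_eqF b_gt0) ?implybT // powR_inv1 ?ltW //.
  by rewrite -p_sqr exprSr.
apply: is_derive_eq (is_deriveM dpow (is_derive_cst a0 t 1)) _.
rewrite /bernoulli_amplitude -/b -/p p_pred /GRing.scale /=.
have b_p : b t * p ^+ 2 = 1 by rewrite p_sqr mulfV // gt_eqF.
have E_b : (a0 ^+ 2 - 1) * E = a0 ^+ 2 - b t.
  by rewrite /b /bernoulli_base -/E subKr.
(* Inserting the factor b p ^ 2 = 1 makes the goal a polynomial identity. *)
have -> : k * (p * a0 - (p * a0) ^+ 3) =
          k * (p * (b t * p ^+ 2) * a0 - (p * a0) ^+ 3).
  by rewrite b_p mulr1.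
have -> : 2 * k * (a0 ^+ 2 - 1) * E = 2 * k * (a0 ^+ 2 - b t).
  by rewrite -E_b; ring.
by field.
Qed.

Lemma is_derive_right_quotient (R : realType) (f : R -> R) (l : R) :
  is_derive (0 : R) 1 f l -> h^-1 * (f h - f 0) @[h --> 0^'+] --> l.
Proof.
move=> [f_deriv <-]; apply: cvg_dnbhs_at_right.
have := f_deriv; rewrite /derivable /derive => /cvg_ex[/= L fL].
rewrite (cvg_lim _ fL) //.
by apply: cvg_trans fL; apply: near_eq_cvg; near=> h; rewrite /GRing.scale /= mulr1 addr0.
Unshelve. all: by end_near. Qed.

Lemma cvg_bernoulli_amplitude (R : realType) (k a0 : R) :
  0 < k -> 0 < a0 -> bernoulli_amplitude k a0 t @[t --> +oo] --> (1 : R).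
Proof.
move=> k_gt0 a0_gt0.
have base_cvg : bernoulli_base k a0 t @[t --> +oo] --> a0 ^+ 2.
  rewrite -[X in _ --> X]subr0 -[X in _ - X](mulr0 (a0 ^+ 2 - 1)).
  apply: cvgB; first exact: cvg_cst.
  apply: cvgM; first exact: cvg_cst.
  have k2_gt0 : 0 < 2 * k by rewrite mulr_gt0.
  have lin_cvg : 2 * k * t @[t --> +oo] --> +oo.
    by apply: gt0_cvgMry => //; exact: cvg_id.
  have exp_cvg := cvg_comp _ _ lin_cvg (@cvgr_expR R).
  by under eq_fun do rewrite !mulNr.
have pow_cont : {for a0 ^+ 2, continuous (fun b : R => b `^ (- 2^-1))}.
  apply/differentiable_continuous/derivable1_diffP.
  by have [] := is_derive1_powR (- 2^-1) (exprn_gt0 2 a0_gt0).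
(* The power is 1 / |a0|: the sign of a0 decides between the limits 1 and - 1. *)
have -> : 1 = (a0 ^+ 2) `^ (- 2^-1) * a0.
  rewrite -powR_mulrn ?ltW // -powRrM mulrN divff ?pnatr_eq0 //.
  by rewrite powR_inv1 ?ltW // mulVf // gt_eqF.
apply: cvgM; last exact: cvg_cst.
exact: cvg_comp base_cvg pow_cont.
Unshelve. all: by end_near. Qed.

(** * The exact solution *)

Theorem theorem2 (R : realType) (N : nat) (e : rel 'I_N) (r mu alpha0 : R)
    (xstar : 'cV[R]_N) :
  simple_graph e -> connected_graph e -> 0 < r ->
  stationary e r xstar -> laplacian_eigenvector e mu xstar ->
  let x0 := alpha0 *: xstar in
  let sol (t : R) :=
    ((alpha0 ^+ 2 - (alpha0 ^+ 2 - 1) * expR (- 2 * mu * r * t))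
       `^ (- 2^-1)) *: x0 in
  is_solution e r x0 sol /\
  (forall x : R -> 'cV[R]_N, is_solution e r x0 x ->
     (forall t : R, 0 <= t -> x t = sol t) /\
     (0 < alpha0 -> x t @[t --> +oo] --> xstar)).
Proof.
move=> e_simple e_conn r_gt0 x_stat x_eigenvector x0 sol.
have mu_gt0 := laplacian_eigenvalue_gt0 e_simple e_conn x_eigenvector.
have k_gt0 : 0 < mu * r by rewrite mulr_gt0.
have [_ _ x_eig] := x_eigenvector.
have solE t : sol t = bernoulli_amplitude (mu * r) alpha0 t *: xstar.
  by rewrite /sol /x0 scalerA /bernoulli_amplitude /bernoulli_base !mulrA.
have sol0 : sol 0 = x0 by rewrite solE bernoulli_amplitude0.
have sol_derive (t : R) i : 0 <= t ->
    is_derive t 1 (fun s : R => sol s i 0) (rhs e r (sol t) i 0).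
  move=> t_ge0.
  have -> : (fun s => sol s i 0) =
            bernoulli_amplitude (mu * r) alpha0 * cst (xstar i 0).
    by apply/funext => s; rewrite solE mxE.
  have damp := is_derive_bernoulli_amplitude
                 (bernoulli_base_gt0 alpha0 k_gt0 t_ge0).
  apply: is_derive_eq (is_deriveM damp (is_derive_cst (xstar i 0) t 1)) _.
  rewrite solE (rhs_ray _ e_simple x_stat x_eig) !mxE /GRing.scale /=; ring.
have sol_solution : is_solution e r x0 sol.
  split=> // [i|t i t_gt0]; last exact: sol_derive (ltW t_gt0).
  by apply: is_derive_right_quotient; exact: sol_derive.
split=> // x x_sol.
have x_eq : forall t : R, 0 <= t -> x t = sol t.
  by apply: (is_solution_unique _ (ltW r_gt0) x_sol sol_solution); case: e_simple.
split=> // alpha0_gt0.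
have ray_cvg := cvgZr_tmp (a := xstar)
  (cvg_bernoulli_amplitude k_gt0 alpha0_gt0) _.
rewrite scale1r in ray_cvg.
apply: cvg_trans (ray_cvg _); apply: near_eq_cvg; near=> t.
by rewrite x_eq ?solE.
Unshelve. all: by end_near. Qed.
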